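(* Let $\mathcal{X}$ be a complex Banach space with $\dim \mathcal{X}\geq 2$, let $\mathcal{U}\subseteq B(\mathcal{X})$ be a standard operator algebra containing the identity operator $I$, and let $n\geq 2$ be a fixed integer. Let $\phi:\mathcal{U}\rightarrow\mathcal{U}$ be a linear mapping which satisfies at least one of the conditions $\mathbf{(N)}$, $\mathbf{(N_l)}$, $\mathbf{(N_r)}$, $\mathbf{(T)}$, $\mathbf{(T_l)}$, $\mathbf{(T_r)}$ (for this $n$). Then $\phi$ is an $n$-commuting map.
   Context: All algebras and vector spaces are over $\mathbb{C}$. For a complex Banach space $\mathcal{X}$, $B(\mathcal{X})$ is the algebra of all bounded linear operators on $\mathcal{X}$ and $F(\mathcal{X})$ is its ideal of finite rank operators. A standard operator algebra over $\mathcal{X}$ is any subalgebra of $B(\mathcal{X})$ containing $F(\mathcal{X})$ (no closedness is assumed). For elements of an algebra $\mathcal{U}$, $[a,b]=ab-ba$, and $p_n$ is defined recursively by $p_1(a_1)=a_1$ and $p_n(a_1,\dots,a_n)=[p_{n-1}(a_1,\dots,a_{n-1}),a_n]$ for $n\geq 2$. A map $\varphi:\mathcal{U}\to\mathcal{U}$ is $n$-commuting ($n\geq 2$) if $p_n(\varphi(a),a,\dots,a)=0$ for all $a\in\mathcal{U}$. For a fixed integer $n\geq 2$ and a linear map $\phi:\mathcal{U}\to\mathcal{U}$, consider the following conditions: - $\mathbf{(T_l)}$: $\phi(p_n(a_1,a_2,\dots,a_n))=p_n(\phi(a_1),a_2,\dots,a_n)$ for all $a_1,\dots,a_n\in\mathcal{U}$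 with $a_1a_2=0$. - $\mathbf{(T_r)}$: $\phi(p_n(a_1,a_2,\dots,a_n))=p_n(a_1,\phi(a_2),a_3,\dots,a_n)$ for all $a_1,\dots,a_n\in\mathcal{U}$ with $a_1a_2=0$. - $\mathbf{(T)}$: both $\mathbf{(T_l)}$ and $\mathbf{(T_r)}$ hold. - $\mathbf{(N_l)}$: $\phi(p_n(a_1,a_2,\dots,a_n))=p_n(\phi(a_1),a_2,\dots,a_n)$ for all $a_1,\dots,a_n\in\mathcal{U}$ with $a_1a_2\cdots a_n=0$. - $\mathbf{(N_r)}$: $\phi(p_n(a_1,a_2,\dots,a_n))=p_n(a_1,\phi(a_2),a_3,\dots,a_n)$ for all $a_1,\dots,a_n\in\mathcal{U}$ with $a_1a_2\cdots a_n=0$. - $\mathbf{(N)}$: both $\mathbf{(N_l)}$ and $\mathbf{(N_r)}$ hold. *)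

(* Defs.v *)
From HB Require Import structures.
From mathcomp Require Import all_boot all_order all_algebra.
From mathcomp Require Import all_classical all_reals all_analysis.
From mathcomp Require Export complex.

Set Implicit Arguments.
Unset Strict Implicit.
Unset Printing Implicit Defensive.

Import Order.TTheory GRing.Theory Num.Theory.
Import numFieldNormedType.Exports.

Local Open Scope classical_set_scope.
Local Open Scope ring_scope.

Section LinearAlgebra.
Variables (K : fieldType) (V : lmodType K).

Definition lin_indep (n : nat) (e : 'I_n -> V) : Prop :=
  forall c : 'I_n -> K, \sum_i c i *: e i = 0 -> forall i, c i = 0.

(* V may be infinite dimensional. *)
Definition dim_ge (n : nat) : Prop := exists e : 'I_n -> V, lin_indep e.

Definition finite_rank (f : V -> V) : Prop :=
  exists (n : nat) (e : 'I_n -> V),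
    forall x, exists c : 'I_n -> K, f x = \sum_i c i *: e i.

End LinearAlgebra.

Section BoundedOperators.
Variables (K : numFieldType) (X : normedModType K).

(* When X is not trivial, the inequality forces M to be a real scalar. *)
Definition bounded_op (f : X -> X) : Prop :=
  exists M : K, forall x, `|f x| <= M * `|x|.

Definition bounded_linear : {pred X -> X} :=
  fun f => `[< linear f /\ bounded_op f >].

Record bop := BOp {
  bop_fun :> X -> X;
  bop_subproof : bop_fun \in bounded_linear }.

HB.instance Definition _ := [isSub for bop_fun].
HB.instance Definition _ := [Choice of bop by <:].

Lemma bounded_linearP (f : X -> X) :
  reflect (linear f /\ bounded_op f) (f \in bounded_linear).
Proof. exact: asboolP. Qed.

Lemma bop_linear (f : bop) : linear f.
Proof. by case: f => f /= /bounded_linearP[]. Qed.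

Lemma bop_bounded (f : bop) : bounded_op f.
Proof. by case: f => f /= /bounded_linearP[]. Qed.

HB.instance Definition _ (f : bop) :=
  GRing.isLinear.Build K X X *:%R (f : X -> X) (bop_linear f).

Lemma bounded_op_continuousP (f : {linear X -> X}) :
  bounded_op f <-> continuous f.
Proof.
split=> [[M fM]|/linear_bounded_continuous/linear_boundedP].
  apply/linear_bounded_continuous/ex_bound; exists `|M|.
  apply/nbhs_norm0P; exists 1 => //= x /ltW x1.
  apply: (le_trans (fM x)).
  have <- : `|M * `|x| | = M * `|x|.
    by apply/ger0_norm/(le_trans _ (fM x)).
  by rewrite normrM normr_id ler_piMr.
by move=> /pinfty_ex_gt0[M _ fM]; exists M.
Qed.

Fact bounded_linear_closed : GRing.subsemimod_closed bounded_linear.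
Proof.
split; first split.
- apply/bounded_linearP; split; first by move=> a x y; rewrite /= scaler0 addr0.
  by exists 0 => x; rewrite mul0r normr0.
- move=> f g /bounded_linearP[lf [M fM]] /bounded_linearP[lg [N gN]].
  apply/bounded_linearP; split.
    by move=> a x y; rewrite /= !fctE lf lg scalerDr addrACA.
  exists (M + N) => x; rewrite mulrDl.
  by apply: (le_trans (ler_normD _ _)); rewrite lerD.
- move=> a f /bounded_linearP[lf [M fM]]; apply/bounded_linearP; split.
    move=> b x y; rewrite /= !fctE lf scalerDr !scalerA.
    by rewrite [a * b]mulrC.
  exists (`|a| * M) => x.
  by rewrite fctE normrZ -mulrA ler_wpM2l.
Qed.

HB.instance Definition _ := GRing.SubChoice_isSubLmodule.Build K (X -> X)
  bounded_linear bop bounded_linear_closed.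

Fact bop_one_subproof : id \in bounded_linear.
Proof.
apply/bounded_linearP; split=> //.
by exists 1 => x; rewrite mul1r.
Qed.

Fact bop_comp_subproof (f g : bop) : f \o g \in bounded_linear.
Proof.
apply/bounded_linearP; split.
  by move=> a x y /=; rewrite !linearP.
have [M fM] := bop_bounded f; have [N gN] := bop_bounded g.
exists (`|M| * N) => x /=; apply: (le_trans (fM _)).
have <- : `|M * `|g x| | = M * `|g x|.
  by apply/ger0_norm/(le_trans _ (fM _)).
by rewrite normrM normr_id -mulrA ler_wpM2l.
Qed.

Definition bop_one : bop := BOp bop_one_subproof.
Definition bop_mul (f g : bop) : bop := BOp (bop_comp_subproof f g).

Lemma bopP (f g : bop) : (forall x, f x = g x) -> f = g.
Proof. by move=> fg; apply/val_inj/funext. Qed.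

Fact bop_mulA : associative bop_mul.
Proof. by move=> f g h; apply: bopP. Qed.

Fact bop_mul1 : left_id bop_one bop_mul.
Proof. by move=> f; apply: bopP. Qed.

Fact bop_mulr1 : right_id bop_one bop_mul.
Proof. by move=> f; apply: bopP. Qed.

Fact bop_mulDl : left_distributive bop_mul +%R.
Proof. by move=> f g h; apply: bopP. Qed.

Fact bop_mulDr : right_distributive bop_mul +%R.
Proof. by move=> f g h; apply: bopP => x; apply: (linearD f). Qed.

(* Only a pzRingType: bop is the zero ring when X is trivial. *)
HB.instance Definition _ := GRing.Zmodule_isPzRing.Build bop
  bop_mulA bop_mul1 bop_mulr1 bop_mulDl bop_mulDr.

Definition standard_operator_algebra (U : {pred bop}) : Prop :=
  [/\ GRing.submod_closed U, GRing.mulr_2closed U & forall f : bop, finite_rank f -> f \in U].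

End BoundedOperators.

Section OperatorAlgebra.
Variables (K : numFieldType) (X : normedModType K) (U : {pred bop X}).
Hypotheses (stdU : standard_operator_algebra U) (U1 : 1 \in U).

(* The proofs are parameters so that the algebra structure can be inferred. *)
Definition opalg of standard_operator_algebra U & 1 \in U := {f : bop X | f \in U}.

Local Notation A := (opalg stdU U1).

HB.instance Definition _ := SubChoice.copy A {f : bop X | f \in U}.

Fact opalg_subring_closed : GRing.subring_closed U.
Proof.
have [[U0 lU] mU _] := stdU.
by split=> //; apply: GRing.linear_closedB.
Qed.

Fact opalg_submod_closed : GRing.subsemimod_closed U.
Proof. by have [/GRing.submod_closed_semi] := stdU. Qed.

HB.instance Definition _ :=
  GRing.SubChoice_isSubPzRing.Build (bop X) U A opalg_subring_closed.
HB.instance Definition _ :=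
  GRing.SubZmodule_isSubLmodule.Build K (bop X) U A opalg_submod_closed.

End OperatorAlgebra.

Section LieTypeConditions.
Variable U : pzRingType.

Definition lie (a b : U) : U := a * b - b * a.

(* pn a1 [:: a2; ...; an] is p_n(a1, ..., an). *)
Definition pn (a1 : U) (s : seq U) : U := foldl lie a1 s.

Definition n_commuting (n : nat) (phi : U -> U) : Prop :=
  forall a, pn (phi a) (nseq n.-1 a) = 0.

(* In the conditions below n >= 2 and a1, a2, s stand for a_1, ..., a_n. *)
Definition cond_Tl (n : nat) (phi : U -> U) : Prop :=
  forall (a1 a2 : U) (s : seq U), size [:: a1, a2 & s] = n ->
    a1 * a2 = 0 -> phi (pn a1 (a2 :: s)) = pn (phi a1) (a2 :: s).

Definition cond_Tr (n : nat) (phi : U -> U) : Prop :=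
  forall (a1 a2 : U) (s : seq U), size [:: a1, a2 & s] = n ->
    a1 * a2 = 0 -> phi (pn a1 (a2 :: s)) = pn a1 (phi a2 :: s).

Definition cond_T (n : nat) (phi : U -> U) : Prop :=
  cond_Tl n phi /\ cond_Tr n phi.

Definition cond_Nl (n : nat) (phi : U -> U) : Prop :=
  forall (a1 a2 : U) (s : seq U), size [:: a1, a2 & s] = n ->
    \prod_(a <- [:: a1, a2 & s]) a = 0 ->
    phi (pn a1 (a2 :: s)) = pn (phi a1) (a2 :: s).

Definition cond_Nr (n : nat) (phi : U -> U) : Prop :=
  forall (a1 a2 : U) (s : seq U), size [:: a1, a2 & s] = n ->
    \prod_(a <- [:: a1, a2 & s]) a = 0 ->
    phi (pn a1 (a2 :: s)) = pn a1 (phi a2 :: s).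

Definition cond_N (n : nat) (phi : U -> U) : Prop :=
  cond_Nl n phi /\ cond_Nr n phi.

End LieTypeConditions.

(* Main.v *)
Require Import Defs.
From HB Require Import structures.
From mathcomp Require Import all_boot all_order all_algebra.
From mathcomp Require Import all_classical all_reals all_analysis.
From mathcomp Require Import ring.

Set Implicit Arguments.
Unset Strict Implicit.
Unset Printing Implicit Defensive.

Import Order.TTheory GRing.Theory Num.Theory.
Import numFieldNormedType.Exports.
Local Open Scope ring_scope.
Local Open Scope complex_scope.

(** A tuple with [a1 a2 = 0] also has [a1 a2 ... an = 0], so each of the six
conditions contains (T_l) or (T_r).  Write [[a, b]] for the commutator.

Idempotents turn information about zero products into an identity.  If a
bilinear map [B] vanishes on all pairs with zero product and [e] is idempotent,
then [ae * (1 - e)b = 0 = a(1 - e) * eb] gives [B(ae, b) = B(ae, eb) = B(a, eb)].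
Rank-one idempotents span the ideal [F] of all sums of rank-one operators
([finrank_ind_idem]), so [B(ar, b) = B(a, rb)] for every [r] in [F]
([finrank_balanced]).  For the difference of the two sides of (T_l) or (T_r)
this means that, as soon as [a] or [b] lies in [F],

  [phi(p_n(a, b, c3, ..., cn)) = p_n(phi(a), b, c3, ..., cn)].              (1)

The rest is algebra.  It rests on the fact that [F] is an ideal and that [z] is
central once all [[z, r]], [r] in [F], are central ([finrank_faithful]).
Iterating it, an element all of whose iterated commutators
of a given length vanish is central, so the trailing variables [c3, ..., cn] in
(1) can be dropped at the price of working modulo the center:
  - [[phi a, b] + [phi b, a]] is central ([phi_lie_skew]), by exchanging [a]
    and [b];
  - [theta(a, b) = phi [a, b] - [phi a, b]] is central ([theta_central]).
    Indeed, modulo the center, [[theta(a, b), c]] is antisymmetric in [a, b] by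
    the first item and symmetric in [b, c] by (1) and the Jacobi identity, and a
    function of three variables with these two symmetries is zero;
  - hence, for [r] in [F], [[[phi a, a], r] = [phi a, [a, r]] + [[phi a, r], a]]
    is congruent to [[phi a, [a, r]] + [phi [a, r], a]], which is central by the
    first item.  So [[phi a, a]] is central ([lie_self_central]).

For [n >= 3] this is the claim.  For [n = 2] the first item is an equality, so
changing [a] by an element of [F] does not change [[phi a, a]]; replacing [a] by
[b = (1 - e)a(1 - e)] with [e] a rank-one idempotent gives
[e [phi b, b] e = 0], which a nonzero scalar operator cannot satisfy.

That rank-one operators exist at all is the Hahn-Banach theorem.  It is proved
here for real spaces from minimal sublinear functionals, and transferred to the
complex space by [f(x) = h(x) - i h(ix)]. *)

(** * Lie products in a ring *)

Section LieRing.
Variable A : pzRingType.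
Implicit Types (a b c z : A) (s : seq A).

Lemma lieDl a b c : lie (a + b) c = lie a c + lie b c.
Proof. by rewrite /lie mulrDl mulrDr opprD addrACA. Qed.

Lemma lieDr a b c : lie a (b + c) = lie a b + lie a c.
Proof. by rewrite /lie mulrDl mulrDr opprD addrACA. Qed.

Lemma lieNl a b : lie (- a) b = - lie a b.
Proof. by rewrite /lie mulNr mulrN opprB opprK addrC. Qed.

Lemma lieC a b : lie a b = - lie b a.
Proof. by rewrite /lie opprB. Qed.

Lemma lie0l a : lie 0 a = 0. Proof. by rewrite /lie mul0r mulr0 subrr. Qed.

Lemma lie1l a : lie 1 a = 0. Proof. by rewrite /lie mul1r mulr1 subrr. Qed.

Lemma lie1r a : lie a 1 = 0. Proof. by rewrite /lie mul1r mulr1 subrr. Qed.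

Lemma lie_jacobi a b c : lie (lie a b) c = lie a (lie b c) + lie (lie a c) b.
Proof.
rewrite /lie !mulrBl !mulrBr !mulrA.
(* the two triple products acb and bca occur in the right-hand side with both signs *)
rewrite !opprB !addrA [RHS](ACl (1*8*3*6*(2*5)*(4*7))%AC) /=.
by rewrite !addNr !addr0.
Qed.

Lemma pn_cons a b s : pn a (b :: s) = pn (lie a b) s.
Proof. by []. Qed.

Lemma pnD a b s : pn (a + b) s = pn a s + pn b s.
Proof. by elim: s a b => [//|c s IHs] a b; rewrite !pn_cons lieDl IHs. Qed.

Lemma pnN a s : pn (- a) s = - pn a s.
Proof. by elim: s a => [//|c s IHs] a; rewrite !pn_cons lieNl IHs. Qed.

Lemma pn0 s : pn (0 : A) s = 0.
Proof. by elim: s => [//|c s IHs]; rewrite pn_cons lie0l. Qed.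

Definition central z := forall a, lie z a = 0.

Lemma central0 : central 0. Proof. exact: lie0l. Qed.

Lemma centralD z1 z2 : central z1 -> central z2 -> central (z1 + z2).
Proof. by move=> c1 c2 a; rewrite lieDl c1 c2 addr0. Qed.

Lemma centralN z : central z -> central (- z).
Proof. by move=> cz a; rewrite lieNl cz oppr0. Qed.

Lemma centralB z1 z2 : central z1 -> central z2 -> central (z1 - z2).
Proof. by move=> c1 /centralN; apply: centralD. Qed.

End LieRing.

(** * Maps that commute with Lie products meeting an ideal *)

Lemma sub_cancel (V : zmodType) (p q x y : V) :
  p - (x + y) - (q - y) = p - x - q.
Proof. by rewrite opprB opprD !addrA subrK. Qed.

Lemma cyclic_sum (V : zmodType) (x y z : V) :
  x - y - (- y - - z) + (z - - x) = x + x.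
Proof. by rewrite !opprK opprD opprK !addrA subrK subrK. Qed.

(** Only what the argument uses of the finite-rank operators: faithfulness is
asked for the iterated commutator, so that it can be applied repeatedly. *)
Record lie_faithful_ideal (A : pzRingType) (F : A -> Prop) : Prop := {
  ideal_B : forall r s, F r -> F s -> F (r - s);
  ideal_Ml : forall a r, F r -> F (a * r);
  ideal_Mr : forall a r, F r -> F (r * a);
  ideal_faithful : forall z, (forall r, F r -> central (lie z r)) -> central z
}.

Section Centralizer.
Variables (A : pzRingType) (F : A -> Prop).
Hypotheses (idF : lie_faithful_ideal F) (A2 : forall a : A, a + a = 0 -> a = 0).
Implicit Types (a b c r t z : A) (s : seq A).

Lemma ideal_lie a b : F a \/ F b -> F (lie a b).
Proof.
by case=> ?; apply: (ideal_B idF);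
  by [apply: (ideal_Ml idF) | apply: (ideal_Mr idF)].
Qed.

(** Engel-like induction: each variable of the iterated commutator is removed by
one application of faithfulness. *)
Lemma pn_eq0_central k z : (forall s, size s = k -> pn z s = 0) -> central z.
Proof.
elim: k z => [|k IHk] z pz0; first by rewrite (pz0 [::] erefl : z = 0); apply: central0.
apply: (ideal_faithful idF) => r _; apply: IHk => s sk.
by rewrite -pn_cons pz0 //= sk.
Qed.

Variables (phi : {additive A -> A}) (m : nat).
Hypothesis phi_pn : forall a b s, size s = m -> F a \/ F b ->
  phi (pn (lie a b) s) = pn (lie (phi a) b) s.

(** By [phi_pn] for [(a, b)] and for [(b, a)], the two summands are the images
under [phi] of opposite elements. *)
Lemma phi_lie_skew_pn a b s : size s = m -> F a \/ F b ->
  pn (lie (phi a) b + lie (phi b) a) s = 0.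
Proof.
move=> sm Fab; have Fba : F b \/ F a by case: Fab; [right|left].
by rewrite pnD -!phi_pn// [lie b a]lieC pnN raddfN subrr.
Qed.

Lemma phi_lie_skew a b : F a \/ F b -> central (lie (phi a) b + lie (phi b) a).
Proof. by move=> Fab; apply: (pn_eq0_central (k := m)) => s sm; apply: phi_lie_skew_pn. Qed.

(* the defect of phi from commuting with the Lie product *)
Local Notation theta a b := (phi (lie a b) - lie (phi a) b).

(** Apply [phi] to the Jacobi identity for [a, b, c]: [phi_pn] rewrites each of
its three terms, provided that of any two of the elements at least one is in [F].  The rest of
the expression is the Jacobi identity for [phi a, b, c]. *)
Lemma theta_sym a b c : F a \/ F b -> F b \/ F c -> F a \/ F c ->
  central (lie (theta a b) c - lie (theta a c) b).
Proof.
move=> Fab Fbc Fac.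
have Fab_c : F (lie a b) \/ F c by case: Fac => ?; [left; apply: ideal_lie; left|right].
have Fac_b : F (lie a c) \/ F b by case: Fab => ?; [left; apply: ideal_lie; left|right].
have Fa_bc : F a \/ F (lie b c) by case: Fac => ?; [left|right; apply: ideal_lie; right].
apply: (pn_eq0_central (k := m)) => s sm.
rewrite !lieDl !lieNl lie_jacobi sub_cancel 2!pnD 2!pnN -!phi_pn //.
by rewrite (lie_jacobi a b c) pnD raddfD addrAC addrK subrr.
Qed.

Lemma central_double z : central (z + z) -> central z.
Proof. by move=> czz a; apply: A2; rewrite -lieDl. Qed.

Lemma theta_skew_lie a b c : F a \/ F b ->
  lie (theta a b) c = - lie (theta b a) c.
Proof.
move=> Fab; apply/eqP; rewrite -addr_eq0 -lieDl addrACA -raddfD -opprD.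
rewrite lieDl lieNl phi_lie_skew// subr0 [lie b a]lieC subrr raddf0.
by rewrite lie0l.
Qed.

(** Modulo the center, [lie (theta a b) c] is antisymmetric in [a, b] and
symmetric in [b, c].  Alternating these two exchanges three times restores the
order of the variables with a minus sign, so twice this element is central. *)
Lemma theta_central a b : F a \/ F b -> central (theta a b).
Proof.
move=> Fab; apply: (ideal_faithful idF) => c Fc; apply: central_double.
have sym x y z : F x \/ F y -> F y \/ F z -> F x \/ F z ->
    central (lie (theta x y) z - lie (theta x z) y) by exact: theta_sym.
have skew := theta_skew_lie.
have Fba : F b \/ F a by case: Fab; [right|left].
have := centralD (centralB (sym a b c Fab (or_intror Fc) (or_intror Fc))
  (sym c a b (or_introl Fc) Fab (or_introl Fc)))
  (sym b c a (or_intror Fc) (or_introl Fc) Fba).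
rewrite (skew c a) ?(skew c b) ?(skew b a) //; [|by left|by left].
by rewrite cyclic_sum.
Qed.

(** By the Jacobi identity, [lie (lie (phi a) a) r] is
[lie (phi a) (lie a r) + lie (lie (phi a) r) a]; centrality of [theta a r] turns
the second term into [lie (phi (lie a r)) a], and the sum is of the form treated
in [phi_lie_skew]. *)
Lemma lie_self_central a : central (lie (phi a) a).
Proof.
apply: (ideal_faithful idF) => r Fr.
have Far : F a \/ F (lie a r) by right; apply: ideal_lie; right.
have theta0 : lie (phi (lie a r)) a = lie (lie (phi a) r) a.
  apply/eqP; rewrite -subr_eq0 -lieNl -lieDl.
  by rewrite (theta_central (or_intror Fr)).
by rewrite lie_jacobi -theta0; apply: phi_lie_skew.
Qed.

Lemma n_commuting_gt2 : (0 < m)%N -> n_commuting m.+2 phi.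
Proof.
move=> m_gt0 a; rewrite -(prednK m_gt0) /= lie_self_central.
exact: pn0.
Qed.

(** Without trailing variables [phi_lie_skew] becomes an equality, so
[lie (phi a) a] depends on [a] only modulo [F].  It can then be computed at
[b = (1 - e) a (1 - e)], where its compression by [e] vanishes; the hypothesis
on [e] says that no nonzero central element has this property. *)
Lemma commuting_2 : m = 0%N ->
  (forall a, exists e, [/\ F e, e * e = e &
     forall z, central z -> e * z * e = 0 -> z = 0]) ->
  n_commuting 2 phi.
Proof.
move=> m0 has_e a /=; have [e [Fe ee zI]] := has_e a.
have skew x y : F x \/ F y -> lie (phi x) y + lie (phi y) x = 0.
  by move=> Fxy; rewrite -(phi_lie_skew_pn (s := [::]) _ Fxy).
have [b [eb be Fab]] : exists b, [/\ e * b = 0, b * e = 0 & F (a - b)].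
  exists (a - a * e - (e * a - e * a * e)); split.
  - by rewrite !mulrBr !mulrA ee subrr.
  - by rewrite !mulrBl -!mulrA ee !subrr.
  - have -> : a - (a - a * e - (e * a - e * a * e)) =
        a * e - (e * a * e - e * a).
      by rewrite !opprB addrC addrA subrK addrC.
    have Fae := ideal_Ml idF a Fe; have Fea := ideal_Mr idF a Fe.
    exact: ideal_B (ideal_B _ (ideal_Mr _ _ _) _).
have bb : lie (phi b) b = 0.
  apply: zI; first exact: lie_self_central.
  by rewrite /lie mulrBr mulrBl !mulrA eb !mul0r -!mulrA be !mulr0 subrr.
suff perturb r : F r -> lie (phi (r + b)) (r + b) = 0.
  by rewrite /pn /= -[a](subrK b); apply: perturb.
move=> Fr; have rr : lie (phi r) r = 0 by apply: A2; apply: skew; left.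
by rewrite raddfD lieDl !lieDr bb addr0 rr add0r skew //; left.
Qed.

End Centralizer.

(** * Balanced maps vanishing at the identity *)

Section BalancedMaps.
Variables (A : pzRingType) (F : A -> Prop).
Hypothesis idF : lie_faithful_ideal F.
Variables (W : zmodType) (B : A -> A -> W).
Hypothesis balanced : forall r x y, F r -> B (x * r) y = B x (r * y).

(** Balancedness moves any factor in [F] across, so the value at a pair meeting
[F] is a value at a pair whose second component is [1]. *)
Lemma balanced_eq0_r a b : (forall x, B x 1 = 0) -> F a \/ F b -> B a b = 0.
Proof.
move=> B1 [Fa|Fb]; last by rewrite -[b]mulr1 -balanced.
rewrite -[a]mul1r balanced // -[a * b]mulr1 -balanced ?B1 //.
exact: ideal_Mr.
Qed.

Lemma balanced_eq0_l a b : (forall y, B 1 y = 0) -> F a \/ F b -> B a b = 0.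
Proof.
move=> B1 [Fa|Fb]; first by rewrite -[a]mul1r balanced.
rewrite -[b]mulr1 -balanced // -[a * b]mul1r balanced ?B1 //.
exact: ideal_Ml.
Qed.
End BalancedMaps.

(** * Bounded functionals: the Hahn-Banach theorem *)

Section ScalarMaps.
Variables (K : pzRingType) (V : lmodType K) (f : V -> K).
Hypothesis lf : scalar f.

Lemma scalar0 : f 0 = 0.
Proof. by have := lf (-1) 0 0; rewrite scaler0 addr0 mulN1r addNr. Qed.

Lemma scalar_mulZ c x : f (c *: x) = c * f x.
Proof. by have := lf c x 0; rewrite !addr0 scalar0 addr0. Qed.

Lemma scalarN x : f (- x) = - f x.
Proof. by rewrite -scaleN1r scalar_mulZ mulN1r. Qed.
End ScalarMaps.

Section Sublinear.
Variables (R : realType) (V : lmodType R).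
Implicit Types (p q : V -> R) (x y : V) (t : R).
Local Open Scope classical_set_scope.

(** An inequality suffices for homogeneity, see [sublinearZ], and is what passes
to infima. *)
Definition sublinear q :=
  (forall x y, q (x + y) <= q x + q y) /\
  (forall t x, 0 <= t -> q (t *: x) <= t * q x).

Lemma sublinear0 q : sublinear q -> q 0 = 0.
Proof.
move=> [qD qZ]; apply/eqP; rewrite eq_le; apply/andP; split.
  by have := qZ 0 0 (lexx 0); rewrite scale0r mul0r.
by have := qD 0 0; rewrite addr0 -subr_ge0 addrK.
Qed.

Lemma sublinearZ q t x : sublinear q -> 0 <= t -> q (t *: x) = t * q x.
Proof.
move=> sq; rewrite le_eqVlt => /predU1P[<-|t0].
  by rewrite scale0r mul0r sublinear0.
apply/eqP; rewrite eq_le (sq.2 _ _ (ltW t0)) /= -ler_pdivlMl //.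
rewrite -[in leLHS](scale1r x) -(mulVf (lt0r_neq0 t0)) -scalerA.
by apply: sq.2; rewrite invr_ge0 ltW.
Qed.

Lemma sublinearN q x : sublinear q -> - q (- x) <= q x.
Proof.
move=> sq; rewrite -subr_ge0 opprK -(sublinear0 sq) -(subrr x).
exact: sq.1.
Qed.

(** Common to the two infima below, over a half-line and over a chain. *)
Lemma inf_sublinear (G : V -> set R) :
  (forall x, G x !=set0) -> (forall x, has_lbound (G x)) ->
  (forall x y u v, G x u -> G y v -> exists2 w, G (x + y) w & w <= u + v) ->
  (forall t x u, 0 <= t -> G x u -> exists2 w, G (t *: x) w & w <= t * u) ->
  sublinear (fun x => inf (G x)).
Proof.
move=> G0 Glb GD GZ; split=> [x y|t x t0].
  rewrite -lerBlDr; apply: lb_le_inf => // u Gu.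
  rewrite lerBlDr -lerBlDl; apply: lb_le_inf => // v Gv.
  have [w Gw wuv] := GD _ _ _ _ Gu Gv.
  by rewrite lerBlDl (le_trans _ wuv)// ge_inf.
have infZ u : G x u -> inf (G (t *: x)) <= t * u.
  by move=> Gu; have [w Gw wtu] := GZ t x u t0 Gu; rewrite (le_trans _ wtu) ?ge_inf.
move: t0; rewrite le_eqVlt => /predU1P[t0|t0].
  by have [u /infZ] := G0 x; rewrite -t0 !mul0r.
rewrite -ler_pdivrMl //; apply: lb_le_inf => // u /infZ.
by rewrite ler_pdivrMl.
Qed.

(** The sublinear functional [x |-> inf_(t >= 0) (q (x + t y) - t q y)]: the term
at [t = 0] gives [q' <= q] and the term at [t = 1] the value at [- y].  As
[- q y <= q (- y)] always holds, [q' = q] forces [q (- y) = - q y]. *)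
Lemma sublinear_tilt q y : sublinear q -> exists q',
  [/\ sublinear q', forall x, q' x <= q x & q' (- y) <= - q y].
Proof.
move=> sq; have [qD qZ] := sq.
pose G x := [set q (x + t *: y) - t * q y | t in [set t | 0 <= t]].
have Glb x : has_lbound (G x).
  exists (- q (- x)) => _ [t t0 <-].
  rewrite -sublinearZ // lerBrDl lerBlDr.
  by rewrite -[in leLHS](addKr x (t *: y)) addrC qD.
exists (fun x => inf (G x)); split.
- apply: inf_sublinear => // [x|x x' _ _ [t t0 <-] [t' t0' <-]|t x _ t0 [t' t0' <-]].
  + by exists (q (x + 0 *: y) - 0 * q y), 0 => //=.
  + exists (q (x + x' + (t + t') *: y) - (t + t') * q y).
      by exists (t + t') => //=; apply: addr_ge0.
    by rewrite mulrDl opprD scalerDl addrACA [leRHS]addrACA lerD2r.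
  + exists (q (t *: x + (t * t') *: y) - (t * t') * q y).
      by exists (t * t') => //=; apply: mulr_ge0.
    by rewrite mulrBr mulrA lerD2r -scalerA -scalerDr qZ.
- move=> x; apply: ge_inf => //; exists 0 => //=.
  by rewrite scale0r mul0r addr0 subr0.
- apply: ge_inf => //; exists 1 => //=.
  by rewrite scale1r addNr sublinear0// mul1r sub0r.
Qed.

Definition minorant p q := sublinear q /\ forall x, q x <= p x.

Lemma chain_lower_bound p (C : set {q | minorant p q}) :
  sublinear p ->
  (forall a b, C a -> C b -> (forall x, sval a x <= sval b x) \/ (forall x, sval b x <= sval a x)) ->
  exists c : {q | minorant p q},
    forall a, C a -> forall x, sval c x <= sval a x.
Proof.
move=> sp chC; have [->|/set0P[a0 Ca0]] := eqVneq C set0.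
  by exists (exist (minorant p) p (conj sp (fun=> lexx _))).
pose G x := [set sval a x | a in C].
have Glb x : has_lbound (G x).
  exists (- p (- x)) => _ [[q [sq qp]] _ <-] /=.
  by rewrite (le_trans _ (sublinearN x sq))// lerN2.
have Gle x a : C a -> inf (G x) <= sval a x by move=> Ca; apply: ge_inf => //; exists a.
suff sG : minorant p (fun x => inf (G x)).
  by exists (exist (minorant p) _ sG) => a Ca x; apply: Gle.
split; last by move=> x; apply: le_trans (Gle _ _ Ca0) _; apply: (svalP a0).2.
apply: inf_sublinear => // [x|x y _ _ [a Ca <-] [b Cb <-]|t x _ t0 [a Ca <-]].
- by exists (sval a0 x), a0.
- have [ab|ba] := chC a b Ca Cb.
    exists (sval a (x + y)); first by exists a.
    by apply: le_trans ((svalP a).1.1 _ _) _; rewrite lerD2l.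
  exists (sval b (x + y)); first by exists b.
  by apply: le_trans ((svalP b).1.1 _ _) _; rewrite lerD2r.
- by exists (sval a (t *: x)); [exists a|apply: (svalP a).1.2].
Qed.

Lemma minimal_sublinear p : sublinear p -> exists h,
  [/\ sublinear h, forall x, h x <= p x &
      forall q, sublinear q -> (forall x, q x <= h x) -> q = h].
Proof.
move=> sp; pose T := {q | minorant p q}.
pose below (a b : T) := `[< forall x, sval b x <= sval a x >].
have belowP a b : below a b <-> forall x, sval b x <= sval a x.
  by split=> [/asboolP|?]; [|apply/asboolP].
have [| | | |h hmin] := @Zorn T below.
- by move=> a; apply/belowP.
- move=> a b c /belowP ab /belowP bc; apply/belowP => x.
  exact: le_trans (bc x) (ab x).
- move=> [q Pq] [q' Pq'] /belowP /= qq' /belowP /= q'q; apply: eq_exist.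
  by apply/funext => x; apply/eqP; rewrite eq_le qq' q'q.
- move=> C totC; have [|c cC] := chain_lower_bound (C := C) sp.
    by move=> a b Ca Cb; have [/belowP|/belowP] := totC _ _ Ca Cb; [right|left].
  by exists c => a Ca; apply/belowP => x; apply: cC.
exists (sval h); split; [exact: (svalP h).1|exact: (svalP h).2|].
move=> q sq qh.
have Pq : minorant p q.
  by split=> // x; apply: le_trans (qh x) _; apply: (svalP h).2.
have : below h (exist (minorant p) q Pq) by apply/belowP.
by move=> /hmin/(congr1 sval).
Qed.

(** Minimality excludes a strictly smaller tilt, so [h] is odd; an odd sublinear
functional is linear, since each inequality also holds at the opposite point. *)
Lemma minimal_sublinear_scalar h : sublinear h ->
  (forall q, sublinear q -> (forall x, q x <= h x) -> q = h) -> scalar h.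
Proof.
move=> sh hmin; have [hD hZ] := sh.
have hN x : h (- x) = - h x.
  apply/eqP; rewrite eq_le; apply/andP; split; last first.
    by rewrite lerNl sublinearN.
  by have [q [sq /(hmin q sq) -> ]] := sublinear_tilt x sh.
have hDE x y : h (x + y) = h x + h y.
  apply/eqP; rewrite eq_le hD /= -lerN2 opprD -!hN opprD.
  exact: hD.
have hZ0 t x : 0 <= t -> h (t *: x) = t * h x.
  move=> t0; apply/eqP; rewrite eq_le hZ //= -lerN2 -mulrN -!hN -scalerN.
  exact: hZ.
move=> t x y; rewrite hDE; congr (_ + _).
have [t0|/ltW t0] := leP 0 t; first exact: hZ0.
apply: oppr_inj; rewrite -hN -scaleNr hZ0 ?mulNr// oppr_ge0 //.
Qed.

(** Tilting [p] along [x0] first fixes the value at [- x0] of every sublinear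
functional below the tilt to be at most [- p x0]. *)
Lemma hahn_banach_support p x0 : sublinear p ->
  exists h, [/\ scalar h, forall x, h x <= p x & h x0 = p x0].
Proof.
move=> sp; have [q [sq qp qx0]] := sublinear_tilt x0 sp.
have [h [sh hq hmin]] := minimal_sublinear sq.
have lh := minimal_sublinear_scalar sh hmin.
exists h; split=> // [x|]; first exact: le_trans (hq x) (qp x).
apply/eqP; rewrite eq_le (le_trans (hq _) (qp _)) /= -lerN2.
apply: le_trans qx0; apply: le_trans (hq _).
by rewrite (scalarN lh).
Qed.
End Sublinear.

Definition bounded_functional (K : numFieldType) (X : normedModType K) (f : X -> K) :=
  scalar f /\ exists M : K, forall x, `|f x| <= M * `|x|.

Section Realification.
Variables (R : realType) (V : lmodType R[i]).

(** An alias, so that the real scalar multiplication does not compete with the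
complex one on [V]. *)
Definition realified : Type := V.
HB.instance Definition _ := GRing.Zmodule.on realified.

Definition real_scale (t : R) (x : realified) : realified := t%:C *: (x : V).

Fact real_scaleA s t x : real_scale s (real_scale t x) = real_scale (s * t) x.
Proof. by rewrite /real_scale scalerA -rmorphM. Qed.

Fact real_scale1 : left_id 1 real_scale.
Proof. by move=> x; rewrite /real_scale scale1r. Qed.

Fact real_scaleDr : right_distributive real_scale +%R.
Proof. by move=> t x y; rewrite /real_scale scalerDr. Qed.

Fact real_scaleDl x : {morph real_scale^~ x : s t / s + t}.
Proof. by move=> s t; rewrite /real_scale rmorphD scalerDl. Qed.

HB.instance Definition _ := GRing.Zmodule_isLmodule.Build R realified
  real_scaleA real_scale1 real_scaleDr real_scaleDl.
End Realification.

Section Dual.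
Variables (R : realType) (X : normedModType R[i]).
Local Notation XR := (realified X).

Definition rnorm (x : X) : R := complex.Re `|x|.

Lemma rnormE x : (rnorm x)%:C = `|x|.
Proof. by rewrite /rnorm RRe_real // ger0_real. Qed.

Lemma rnorm_sublinear : sublinear (rnorm : XR -> R).
Proof.
split=> [x y|t x t0]; rewrite -lecR.
  by rewrite rmorphD /= !rnormE ler_normD.
by rewrite rmorphM /= !rnormE normrZ ger0_norm // ler0c.
Qed.

Lemma normc_real (t : R) : `|t%:C| = `|t|%:C.
Proof. by rewrite normc_def /= expr0n addr0 sqrtr_sqr. Qed.

(** The only complex linear functional whose real part is [h]. *)
Definition complexify (h : X -> R) (x : X) : R[i] := h x -i* h ('i *: x).

Lemma complex_scaleE (a b : R) (x : X) :
  (a +i* b) *: x = a%:C *: x + b%:C *: ('i *: x).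
Proof. by rewrite scalerA -scalerDl; congr (_ *: _); simpc. Qed.

Lemma complexify_scalar h : scalar (h : XR -> R) -> scalar (complexify h).
Proof.
move=> lh.
have hE (a b : R) (x y : X) :
    h ((a +i* b) *: x + y) = a * h x + (b * h ('i *: x) + h y).
  rewrite complex_scaleE -addrA.
  exact: etrans (lh a x _) (congr1 _ (lh b _ y)).
move=> [a b] x y; rewrite /complexify /= hE scalerDr scalerA.
have -> : 'i * (a +i* b) = (- b) +i* a by simpc.
rewrite hE; simpc.
by congr (_ +i* _); ring.
Qed.

(** A functional supporting the norm at [x] is nonzero there; the crude bound
[2 |y|] on its complexification, from its real and imaginary parts, is enough. *)
Lemma exists_bounded_functional (x : X) : x != 0 ->
  exists f : X -> R[i], bounded_functional f /\ f x = 1.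
Proof.
move=> x0.
have [h [lh hp hx]] := @hahn_banach_support R XR _ x rnorm_sublinear.
have lf := complexify_scalar lh.
have f0 : complexify h x != 0.
  rewrite eq_complex /= negb_and hx -(inj_eq (@complexI R)) rnormE.
  by rewrite normr_eq0 x0.
have habs y : `|h y| <= rnorm y.
  rewrite ler_norml hp andbT lerNl.
  rewrite -(scalarN (V := XR) lh); apply: le_trans (hp _) _.
  by rewrite /rnorm normrN.
have fM y : `|complexify h y| <= 2 * `|y|.
  have -> : complexify h y = (h y)%:C - 'i * (h ('i *: y))%:C.
    by rewrite /complexify; simpc.
  apply: (le_trans (ler_normB _ _)).
  have ni : `|'i : R[i]| = 1.
    by rewrite normc_def /= expr0n add0r expr1n sqrtr1.
  rewrite normrM ni mul1r !normc_real mulr2n mulrDl mul1r.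
  apply: lerD; rewrite ?rnormE.
  - by rewrite -rnormE lecR.
  - by rewrite -[`|y|]mul1r -ni -normrZ -rnormE lecR.
exists (fun y => (complexify h x)^-1 * complexify h y); split; last by rewrite mulVf.
split; first by move=> c y z; rewrite lf mulrDr mulrCA.
exists (`|(complexify h x)^-1| * 2) => y.
by rewrite normrM -mulrA ler_wpM2l.
Qed.
End Dual.

(** * Finite-rank operators *)

Section FiniteRank.
Variables (K : numFieldType) (X : normedModType K) (U : {pred bop X}).
Hypotheses (stdU : standard_operator_algebra U) (U1 : 1 \in U).
Local Notation A := (opalg stdU U1).
Implicit Types (a b e r z : A) (x y : X) (f : X -> K) (c : K).

(** Fixes the head symbol under which elements of [A] act, so that products can
be unfolded by [appM] only. *)
Definition app a : X -> X := val a.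

Lemma appP a b : (forall x, app a x = app b x) -> a = b.
Proof. by move=> ab; apply/val_inj/bopP. Qed.

Lemma appM a b x : app (a * b) x = app a (app b x). Proof. by []. Qed.

Lemma app_lin a c x y : app a (c *: x + y) = c *: app a x + app a y.
Proof. exact: bop_linear. Qed.

Lemma appZ a c x : app a (c *: x) = c *: app a x.
Proof. by rewrite /app linearZ. Qed.

Lemma app0 x : app 0 x = 0. Proof. by []. Qed.

Lemma app_comb c a b x : app (c *: a + b) x = c *: app a x + app b x.
Proof. by []. Qed.

Lemma opalg_scalerAl c a b : c *: (a * b) = c *: a * b.
Proof. exact: appP. Qed.

Lemma opalg_scalerAr c a b : c *: (a * b) = a * (c *: b).
Proof. by apply: appP => x; rewrite /= -[LHS]/(c *: app a (app b x)) -appZ. Qed.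

Lemma opalg_double_eq0 a : a + a = 0 -> a = 0.
Proof.
by move=> /eqP; rewrite -mulr2n -scaler_nat scaler_eq0 pnatr_eq0 => /eqP.
Qed.

Definition is_rank1 a x f :=
  bounded_functional f /\ forall y, app a y = f y *: x.

Lemma rank1_ex x f : bounded_functional f -> exists a : A, is_rank1 a x f.
Proof.
move=> bf; have [lf [M fM]] := bf.
have bl : (fun y => f y *: x) \in @bounded_linear K X.
  apply/bounded_linearP; split; first by move=> c y z; rewrite lf scalerDl scalerA.
  exists (M * `|x|) => y.
  by rewrite normrZ mulrAC ler_wpM2r.
have inU : BOp bl \in U.
  have [_ _] := stdU; apply; exists 1%N, (fun=> x) => y.
  by exists (fun=> f y); rewrite big_ord_recl big_ord0 addr0.
by exists (exist (fun g => g \in U) _ inU : A); split.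
Qed.

(** Sums of rank-one operators, each coming with a bounded functional; with
subtraction as a constructor, sums and opposites need no separate one. *)
Inductive finrank : A -> Prop :=
| finrank_rank1 a x f of is_rank1 a x f : finrank a
| finrankB r s of finrank r & finrank s : finrank (r - s).

Lemma finrankMl a r : finrank r -> finrank (a * r).
Proof.
elim=> [b x f [bf bE]|s t _ Fs _ Ft]; last by rewrite mulrBr; apply: finrankB.
apply: (@finrank_rank1 _ (app a x) f); split=> // y.
by rewrite appM bE appZ.
Qed.

Lemma finrankMr a r : finrank r -> finrank (r * a).
Proof.
elim=> [b x f [[lf [M fM]] bE]|s t _ Fs _ Ft].
  apply: (@finrank_rank1 _ x (f \o app a)); split; last by move=> y; rewrite appM bE.
  split; first by move=> c y z; rewrite /= app_lin lf.
  have [N aN] : exists N, forall y, `|app a y| <= N * `|y| := bop_bounded (val a).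
  exists (`|M| * N) => y /=; apply: (le_trans (fM _)).
  have <- : `|M * `|app a y| | = M * `|app a y|.
    by apply/ger0_norm/(le_trans _ (fM _)).
  by rewrite normrM normr_id -mulrA ler_wpM2l.
by rewrite mulrBl; apply: finrankB.
Qed.

Lemma rank1_idem e x f : is_rank1 e x f -> f x = 1 -> e * e = e.
Proof.
move=> [[lf _] eE] fx; apply: appP => y.
by rewrite appM !eE scalar_mulZ // fx mulr1.
Qed.

(** If [f x <> 0], the operator [f (.) x] is a multiple of an idempotent; if
[f x = 0], it is the difference of the idempotents [f (.) (x + t)] and
[f (.) t] for any [t] with [f t = 1]. *)
Lemma finrank_ind_idem (P : A -> Prop) :
  P 0 -> (forall c r s, P r -> P s -> P (c *: r + s)) ->
  (forall e x f, is_rank1 e x f -> f x = 1 -> P e) ->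
  forall r, finrank r -> P r.
Proof.
move=> P0 Plin Pe r; elim=> {r} [a x f [bf aE]|r s _ Pr _ Ps]; last first.
  by rewrite addrC -scaleN1r; apply: Plin.
have [lf _] := bf.
have fZ c y : f (c *: y) = c * f y.
  exact: scalar_mulZ.
have [[y fy]|f0] := pselect (exists y, f y != 0); last first.
  suff -> : a = 0 by [].
  apply: appP => y; rewrite aE app0.
  have -> : f y = 0 by apply/eqP; apply: contra_notT f0 => ?; exists y.
  by rewrite scale0r.
have [fx|fx] := eqVneq (f x) 0; last first.
  have [e eR] := rank1_ex ((f x)^-1 *: x) bf.
  have -> : a = f x *: e + 0.
    apply: appP => t; rewrite app_comb aE eR.2 app0 addr0 !scalerA.
    by rewrite mulrAC divff // mul1r.
  by apply: Plin => //; apply: (Pe _ _ _ eR); rewrite fZ mulVf.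
set t := (f y)^-1 *: y; have ft : f t = 1 by rewrite fZ mulVf.
have [e eR] := rank1_ex t bf; have [e' e'R] := rank1_ex (x + t) bf.
have -> : a = (-1) *: e + e'.
  apply: appP => u; rewrite app_comb aE eR.2 e'R.2 scaleN1r scalerDr.
  by rewrite addrC addrK.
apply: Plin; first exact: (Pe _ _ _ eR).
by apply: (Pe _ _ _ e'R); rewrite -[x]scale1r lf fx ft mul1r add0r.
Qed.

(** For an idempotent [e], both [B (a * e) b] and [B a (e * b)] equal
[B (a * e) (e * b)], because [a * e] kills [(1 - e) * b] and [a * (1 - e)] kills
[e * b]; linearity extends this to the span of the idempotents. *)
Lemma finrank_balanced (B : A -> A -> A) :
  (forall a, linear (B a)) -> (forall b, linear (B^~ b)) ->
  (forall a b, a * b = 0 -> B a b = 0) ->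
  forall r a b, finrank r -> B (a * r) b = B a (r * b).
Proof.
move=> Blr Bll B0 r a b Fr; move: r Fr a b.
have Bl0 b : B 0 b = 0 by apply: B0; rewrite mul0r.
have Br0 a : B a 0 = 0 by apply: B0; rewrite mulr0.
apply: finrank_ind_idem => [a b|c r s Pr Ps a b|e x f eR fx a b].
- by rewrite mul0r mulr0 Bl0 Br0.
- by rewrite mulrDr mulrDl -opalg_scalerAr -opalg_scalerAl Bll Blr Pr Ps.
have ee := rank1_idem eR fx.
have Bbr u v w : B u (v - w) = B u v - B u w.
  by rewrite addrC -scaleN1r Blr scaleN1r addrC.
have Bbl u v w : B (v - w) u = B v u - B w u.
  by rewrite addrC -scaleN1r Bll scaleN1r addrC.
transitivity (B (a * e) (e * b)).
  apply/eqP; rewrite -subr_eq0 -Bbr; apply/eqP/B0.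
  by rewrite mulrBr !mulrA -[a * e * e]mulrA ee subrr.
apply/eqP; rewrite eq_sym -subr_eq0 -Bbl; apply/eqP/B0.
by rewrite mulrBl !mulrA -[a * e * e]mulrA ee subrr.
Qed.

Variables (f0 : X -> K) (x0 : X).
Hypotheses (bf0 : bounded_functional f0) (f0x0 : f0 x0 = 1).

(** A central [z] commutes with all the operators [f (.) y], hence acts as the
scalar [f (z x)], and this scalar is read off from [e z e]. *)
Lemma rank1_compress e x f z : is_rank1 e x f -> f x = 1 ->
  central z -> e * z * e = 0 -> z = 0.
Proof.
move=> [bf eE] fx cz eze.
have comm a u : app z (app a u) = app a (app z u).
  by rewrite -!appM; have /eqP := cz a; rewrite subr_eq0 => /eqP ->.
have ex : app e x = x by rewrite eE fx scale1r.
have fzx : f (app z x) *: x = 0.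
  by rewrite -eE -[RHS](app0 x) -eze !appM ex.
have [lf _] := bf.
have {}fzx : f (app z x) = 0.
  by have := scalar_mulZ lf (f (app z x)) x; rewrite fzx (scalar0 lf) fx mulr1.
apply: appP => y; have [a [_ aE]] := rank1_ex y bf.
by rewrite app0 -[y]scale1r -fx -aE comm aE fzx scale0r.
Qed.

(** If [lie z e] is central for an idempotent [e], it vanishes, because
[e (ze - ez) e = 0]; so [z] commutes with [finrank].  Each [y] is the value at
[x0] of an operator [r] of rank one, and [z a r = a r z = a z r]. *)
Lemma finrank_faithful : lie_faithful_ideal finrank.
Proof.
split; [exact: finrankB|exact: finrankMl|by move=> ? ?; apply: finrankMr|].
move=> z cz.
have comm : forall r, finrank r -> z * r = r * z.
  apply: finrank_ind_idem => [|c r s zr zs|e x f eR fx].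
  - by rewrite mul0r mulr0.
  - by rewrite mulrDr mulrDl -opalg_scalerAr -opalg_scalerAl zr zs.
  apply/eqP; rewrite -subr_eq0; apply/eqP.
  apply: (rank1_compress eR fx); first exact: cz (finrank_rank1 eR).
  have ee := rank1_idem eR fx.
  by rewrite mulrBr mulrBl !mulrA ee -!mulrA ee subrr.
move=> a; apply/eqP; rewrite subr_eq0; apply/eqP/appP => y.
have [r rR] := rank1_ex y bf0; have Fr := finrank_rank1 rR.
have yE : y = app r x0 by rewrite rR.2 f0x0 scale1r.
rewrite yE -!appM -!mulrA [in RHS]comm // (mulrA a) -(comm (a * r)) //.
exact: finrankMl.
Qed.

Lemma finrank_unit a : exists e, [/\ finrank e, e * e = e &
  forall z, central z -> e * z * e = 0 -> z = 0].
Proof.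
have [e eR] := rank1_ex x0 bf0; exists e; split.
- exact: finrank_rank1 eR.
- exact: rank1_idem eR f0x0.
- by move=> z; apply: rank1_compress eR f0x0.
Qed.

Lemma opalg_lieZl c a b : lie (c *: a) b = c *: lie a b.
Proof. by rewrite /lie -opalg_scalerAl -opalg_scalerAr scalerBr. Qed.

Lemma opalg_lieZr c a b : lie a (c *: b) = c *: lie a b.
Proof. by rewrite /lie -opalg_scalerAl -opalg_scalerAr scalerBr. Qed.

Lemma opalg_pnZ c a s : pn (c *: a) s = c *: pn a s.
Proof. by elim: s a => [//|b s IHs] a; rewrite !pn_cons opalg_lieZl IHs. Qed.

Lemma opalg_pn_lie_linl b s : linear (fun a => pn (lie a b) s).
Proof. by move=> c a a'; rewrite lieDl opalg_lieZl pnD opalg_pnZ. Qed.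

Lemma opalg_pn_lie_linr a s : linear (fun b => pn (lie a b) s).
Proof. by move=> c b b'; rewrite lieDr opalg_lieZr pnD opalg_pnZ. Qed.

Variables (phi : {linear A -> A}) (m : nat).

(** The defect of (T_l) at [(a, 1)] is zero, as [lie _ 1 = 0]. *)
Lemma cond_Tl_finrank : cond_Tl m.+2 phi ->
  forall a b s, size s = m -> finrank a \/ finrank b ->
  phi (pn (lie a b) s) = pn (lie (phi a) b) s.
Proof.
move=> Tl a b s sm Fab; apply/eqP; rewrite -subr_eq0; apply/eqP.
pose B a b := phi (pn (lie a b) s) - pn (lie (phi a) b) s.
rewrite -/(B a b); apply: (balanced_eq0_r finrank_faithful _ _ Fab); last first.
  by move=> t; rewrite /B !lie1r pn0 raddf0 subrr.
move=> r t u Fr; apply: finrank_balanced => //.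
- move=> v c w w'; rewrite /B !opalg_pn_lie_linr linearP.
  by rewrite scalerBr opprD addrACA.
- move=> v c w w'; rewrite /B /= linearP !opalg_pn_lie_linl linearP.
  by rewrite scalerBr opprD addrACA.
- by move=> v w vw; rewrite /B; apply/eqP; rewrite subr_eq0 -!pn_cons Tl //= sm.
Qed.

(** The defect of (T_r) at [(1, b)] is zero, as [lie 1 _ = 0].  The identity
obtained concerns the second argument of the Lie product; exchanging the two
arguments moves [phi] to the first one. *)
Lemma cond_Tr_finrank : cond_Tr m.+2 phi ->
  forall a b s, size s = m -> finrank a \/ finrank b ->
  phi (pn (lie a b) s) = pn (lie (phi a) b) s.
Proof.
move=> Tr a b s sm Fab.
rewrite lieC [lie (phi a) b]lieC !pnN raddfN; congr (- _).
apply/eqP; rewrite -subr_eq0; apply/eqP.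
have {}Fab : finrank b \/ finrank a by case: Fab; [right|left].
pose B a b := phi (pn (lie a b) s) - pn (lie a (phi b)) s.
rewrite -/(B b a); apply: (balanced_eq0_l finrank_faithful _ _ Fab); last first.
  by move=> t; rewrite /B !lie1l pn0 raddf0 subrr.
move=> r t u Fr; apply: finrank_balanced => //.
- move=> v c w w'; rewrite /B linearP !opalg_pn_lie_linr linearP.
  by rewrite scalerBr opprD addrACA.
- move=> v c w w'; rewrite /B /= !opalg_pn_lie_linl linearP.
  by rewrite scalerBr opprD addrACA.
- by move=> v w vw; rewrite /B; apply/eqP; rewrite subr_eq0 -!pn_cons Tr //= sm.
Qed.

Lemma cond_T_n_commuting :
  cond_Tl m.+2 phi \/ cond_Tr m.+2 phi -> n_commuting m.+2 phi.
Proof.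
move=> T.
have phi_pn a b s : size s = m -> finrank a \/ finrank b ->
    phi (pn (lie a b) s) = pn (lie (phi a) b) s.
  by case: T => T; [apply: cond_Tl_finrank|apply: cond_Tr_finrank].
have [m0|m_gt0] := posnP m; last first.
  exact: (n_commuting_gt2 finrank_faithful opalg_double_eq0 phi_pn).
rewrite m0; apply: (commuting_2 finrank_faithful opalg_double_eq0 phi_pn m0).
exact: finrank_unit.
Qed.

End FiniteRank.

Lemma cond_Nl_Tl (A : pzRingType) n (phi : A -> A) : cond_Nl n phi -> cond_Tl n phi.
Proof.
move=> N a1 a2 s sn a12; apply: N => //.
by rewrite !big_cons mulrA a12 mul0r.
Qed.

Lemma cond_Nr_Tr (A : pzRingType) n (phi : A -> A) : cond_Nr n phi -> cond_Tr n phi.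
Proof.
move=> N a1 a2 s sn a12; apply: N => //.
by rewrite !big_cons mulrA a12 mul0r.
Qed.

Lemma dim_ge_neq0 (K : fieldType) (V : lmodType K) n :
  dim_ge V n.+1 -> exists x : V, x != 0.
Proof.
move=> [e ind]; exists (e ord0); apply/eqP => e0.
suff sum0 : \sum_i (i == ord0)%:R *: e i = 0.
  by have /eqP := ind _ sum0 ord0; rewrite eqxx oner_eq0.
rewrite big1 // => i _; have [->|_] := eqVneq i ord0; first by rewrite e0 scaler0.
by rewrite scale0r.
Qed.

Theorem theorem4p1 (R : realType) (X : completeNormedModType R[i])
  (dimX : dim_ge X 2)
  (U : {pred bop X}) (stdU : standard_operator_algebra U) (U1 : 1 \in U)
  (n : nat) (n_ge2 : (2 <= n)%N)
  (phi : {linear opalg stdU U1 -> opalg stdU U1}) :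
  cond_N n phi \/ cond_Nl n phi \/ cond_Nr n phi \/
  cond_T n phi \/ cond_Tl n phi \/ cond_Tr n phi ->
  n_commuting n phi.

Proof.
move=> conds; case: n n_ge2 conds => [|[|m]] // _ conds.
have [x x_neq0] := dim_ge_neq0 dimX.
have [f [bf fx]] := exists_bounded_functional x_neq0.
apply: (cond_T_n_commuting bf fx).
case: conds => [[/cond_Nl_Tl Tl _]|]; first by left.
case=> [/cond_Nl_Tl Tl|]; first by left.
case=> [/cond_Nr_Tr Tr|]; first by right.
case=> [[Tl _]|]; first by left.
by [].
Qed.
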